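(* Let $T$ be an integral domain with $|T|=2^{2^{\aleph_0}}$ and Krull dimension $\dim(T)=1$. Then $T$ has a maximal subring.
   Context: All rings are commutative with $1\neq0$ and subrings are unital. A maximal subring of $T$ is a proper subring maximal with respect to inclusion among proper subrings of $T$. *)

(* Defs.v *)
From HB Require Import structures.
From mathcomp Require Import all_boot all_order all_algebra.
Set Implicit Arguments. Unset Strict Implicit. Unset Printing Implicit Defensive.
Import GRing.Theory.
Local Open Scope ring_scope.

Definition card_2_2_aleph0 (A : Type) : Prop :=
  exists f : A -> ((nat -> Prop) -> Prop), bijective f.

Definition is_ideal (R : comNzRingType) (I : R -> Prop) : Prop :=
  [/\ I 0,
      (forall x y, I x -> I y -> I (x + y)) &
      (forall r x, I x -> I (r * x))].

Definition is_prime_ideal (R : comNzRingType) (P : R -> Prop) : Prop :=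
  [/\ is_ideal P, ~ P 1 & (forall x y, P (x * y) -> P x \/ P y)].

Definition strict_incl (R : Type) (A B : R -> Prop) : Prop :=
  (forall x, A x -> B x) /\ exists x, B x /\ ~ A x.

(* Krull dimension = 1: the supremum of lengths n of chains
   P0 < P1 < ... < Pn of prime ideals is exactly 1, i.e. there is a chain of
   length 1 and no chain of length 2. *)
Definition krull_dim_one (R : comNzRingType) : Prop :=
  (exists P Q : R -> Prop,
      [/\ is_prime_ideal P, is_prime_ideal Q & strict_incl P Q]) /\
  ~ (exists P Q Q' : R -> Prop,
      [/\ is_prime_ideal P, is_prime_ideal Q, is_prime_ideal Q',
          strict_incl P Q & strict_incl Q Q']).

Definition is_subring (R : comNzRingType) (S : R -> Prop) : Prop :=
  [/\ S 1,
      (forall x y, S x -> S y -> S (x - y)) &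
      (forall x y, S x -> S y -> S (x * y))].

Definition is_maximal_subring (R : comNzRingType) (S : R -> Prop) : Prop :=
  [/\ is_subring S,
      (exists x, ~ S x) &
      (forall S' : R -> Prop, is_subring S' -> (exists x, ~ S' x) ->
          (forall x, S x -> S' x) -> forall x, S' x -> S x)].

(* Main.v *)
Require Import Defs.
From HB Require Import structures.
From mathcomp Require Import all_boot all_order all_algebra.
From mathcomp Require Import ring boolp classical_sets functions cardinality.
(** Suppose the domain [T] has no maximal subring.
    If [u] is a unit of a domain [D], transcendental over the prime subring,
    take a subring [A] of [D] maximal among those over which [u] is
    transcendental. Then [D] is algebraic over [A[u]], and the elements of [D]
    integral over [A[u]] localized at [u] form a subring [S] with [1/u] not in
    [S] and [D = S[1/u]]; by Zorn, [D] has a maximal subring. As maximal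
    subrings pull back along surjections, every field [T/P] is algebraic over
    its prime field, hence countable.
    Now [T] is uncountable, so it contains a transcendental [y]; let [B] be the
    subring generated by [y]. For [b <> 0] in [B], [1 + b y] is transcendental,
    so it is not a unit and lies in some maximal ideal [M_b], which misses [b].
    Let [I] be the intersection of the countably many [M_b]. Since [T/I] embeds
    in a countable product of countable sets and [T] has more than [2^aleph_0]
    elements, [I <> 0]. As [I] meets [B] only in [0], there is a prime [P]
    containing [I] with [P] meeting [B] only in [0]; it is maximal because
    [dim T = 1], and [T/P] contains the transcendental image of [y]:
    a contradiction. *)

Set Implicit Arguments. Unset Strict Implicit. Unset Printing Implicit Defensive.
Import GRing.Theory.
Local Open Scope quotient_scope.
Local Open Scope classical_set_scope.
Local Open Scope ring_scope.

(** * Zorn's lemma above a given set *)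

(** Zorn is applied to the sets whose union with [X0] satisfies [P]: this settles the empty chain by
    [PX0] and forces [X0] into the maximal set. *)
Lemma chain_complete_maximal (U : Type) (P : set (set U)) (X0 : set U) :
  P X0 ->
  (forall F : set (set U), F !=set0 -> (F `<=` P) ->
     total_on F subset -> P (\bigcup_(X in F) X)) ->
  exists X, [/\ P X, (X0 `<=` X) &
    forall Y, P Y -> (X `<=` Y) -> (Y `<=` X)].
Proof.
move=> PX0 Pchain.
have [|X [PX maxX]] := @Zorn_bigcup U (fun X => P (X `|` X0)).
  move=> F FP Ftot; have [-> | F0] := eqVneq F set0.
    by rewrite bigcup_set0 set0U.
  have -> : (\bigcup_(X in F) X `|` X0) =
            (\bigcup_(X in [set Y `|` X0 | Y in F]) X).
    apply/seteqP; split=> [x [[Y FY Yx]|X0x] | x [_ [Y FY <-]] [Yx|X0x]].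
    - by exists (Y `|` X0); [exists Y | left].
    - have /set0P[Y FY] := F0.
      by exists (Y `|` X0); [exists Y | right].
    - by left; exists Y.
    - by right.
  apply: Pchain.
  - by have /set0P[Y FY] := F0; exists (Y `|` X0), Y.
  - by move=> _ [Y FY <-]; apply: FP.
  - move=> _ _ [Y FY <-] [Z FZ <-].
    by case: (Ftot _ _ FY FZ) => YZ; [left | right]; apply: setSU.
exists (X `|` X0); split=> [//||Y PY XY]; first by right.
have X0Y : (X0 `<=` Y) by move=> x X0x; apply: XY; right.
have XsY : (X `<=` Y) by move=> x Xx; apply: XY; left.
move=> y Yy; left; apply: contrapT => nXy.
apply: (maxX Y); last by rewrite setUidl.
by rewrite properEneq; split=> //; apply/eqP => XeqY; apply: nXy; rewrite XeqY.
Qed.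

(** * Subrings and prime quotients as ring types *)

Section Subrings.
Variables (R : comNzRingType) (S : R -> Prop).
Hypothesis subS : is_subring S.

Lemma subring0 : S 0.
Proof. by case: subS => S1 SB _; rewrite -(subrr 1); apply: SB. Qed.

Definition subring_mem : {pred R} := fun x => `[< S x >].

Lemma subring_mem_closed : subring_closed subring_mem.
Proof.
case: subS => S1 SB SM.
split=> [|x y /asboolP Sx /asboolP Sy|x y /asboolP Sx /asboolP Sy];
  apply/asboolP => //; [exact: SB | exact: SM].
Qed.

HB.instance Definition _ :=
  GRing.isSubringClosed.Build R subring_mem subring_mem_closed.

Definition subring_sort := {x : R | x \in subring_mem}.

HB.instance Definition _ := SubChoice.on subring_sort.
HB.instance Definition _ := [SubChoice_isSubComNzRing of subring_sort by <:].

(** Trades the predicate for a ring type, over which polynomials can be formed. *)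
Lemma subring_range_rmorphism :
  exists (A : comNzRingType) (f : {rmorphism A -> R}),
    injective f /\ forall x, S x <-> exists a, f a = x.
Proof.
exists subring_sort, (val : {rmorphism subring_sort -> R}).
split; first exact: val_inj.
move=> x; split=> [Sx|[a <-]]; last by apply/asboolP; exact: (valP a).
have memx : x \in subring_mem by apply/asboolP.
by exists (exist _ x memx : subring_sort).
Qed.

End Subrings.

Section PrimeQuotient.
Variables (R : comNzRingType) (P : R -> Prop).
Hypothesis primeP : is_prime_ideal P.

Definition ideal_mem : {pred R} := fun x => `[< P x >].

Lemma ideal_mem_closed : idealr_closed ideal_mem.
Proof.
case: primeP => -[P0 PD PM] P1 _.
split=> [||a x y /asboolP Px /asboolP Py]; apply/asboolP => //.
exact/PD/Py/PM.
Qed.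

HB.instance Definition _ := isIdealr.Build R ideal_mem ideal_mem_closed.

Lemma prime_ideal_quotient :
  exists (D : idomainType) (f : {rmorphism R -> D}),
    (forall d, exists x, f x = d) /\ forall x, f x = 0 <-> P x.
Proof.
case: primeP => _ _ Pprime; pose Q := {ideal_quot ideal_mem}.
have Q_mul_eq0 (x y : Q) : x * y = 0 -> (x == 0) || (y == 0).
  rewrite -[x]reprK -[y]reprK => /eqP.
  rewrite !piE !Quotient.equivE !subr0 => /asboolP/Pprime[] H; apply/orP;
    [left|right]; exact/asboolP.
(* An [idomainType] carries a unit test and a total inverse; both are chosen classically, with
   [inv x = x] at non-units. *)
pose unit := [pred x : Q | `[< exists y, y * x = 1 >]].
pose inv (x : Q) := if pselect (exists y, y * x = 1) is left H
                    then sval (cid H) else x.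
have mulVx : {in unit, left_inverse 1 inv *%R}.
  move=> x /asboolP H; rewrite /inv; case: pselect => // H'.
  by case: cid.
have unitP x y : y * x = 1 -> unit x by move=> yx; apply/asboolP; exists y.
have inv_out : {in [predC unit], inv =1 id}.
  by move=> x /asboolP H; rewrite /inv; case: pselect.
pose U : comUnitRingType := HB.pack Q
  (GRing.ComNzRing_hasMulInverse.Build Q mulVx unitP inv_out).
pose D : idomainType := HB.pack U
  (GRing.ComUnitRing_isIntegral.Build U Q_mul_eq0).
exists D, (\pi_Q : {rmorphism R -> Q}); split.
  by move=> d; exists (repr (d : Q)); exact: (@reprK _ Q).
move=> x; split=> [/eqP|Px].
  by rewrite piE Quotient.equivE subr0 => /asboolP.
apply/eqP; rewrite piE Quotient.equivE subr0; exact/asboolP.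
Qed.

End PrimeQuotient.

(** * Unions of chains; existence and pullback of maximal subrings *)

Lemma total_on_bigcup2 (U : Type) (F : set (set U)) (x y : U) :
  total_on F subset ->
  (\bigcup_(X in F) X) x -> (\bigcup_(X in F) X) y ->
  exists X, [/\ F X, X x & X y].
Proof.
move=> Ftot [X FX Xx] [Y FY Yy].
by case: (Ftot _ _ FX FY) => XY; [exists Y | exists X]; split=> //; apply: XY.
Qed.

Lemma bigcup_subring (R : comNzRingType) (F : set (set R)) :
  F !=set0 -> total_on F subset -> (forall X, F X -> is_subring X) ->
  is_subring (\bigcup_(X in F) X).
Proof.
move=> [X0 FX0] Ftot Fsub; split.
- by exists X0 => //; case: (Fsub _ FX0).
- move=> x y Ux Uy; have [X [FX Xx Xy]] := total_on_bigcup2 Ftot Ux Uy.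
  by exists X => //; case: (Fsub _ FX) => _ + _; apply.
- move=> x y Ux Uy; have [X [FX Xx Xy]] := total_on_bigcup2 Ftot Ux Uy.
  by exists X => //; case: (Fsub _ FX) => _ _; apply.
Qed.

Lemma bigcup_ideal (R : comNzRingType) (F : set (set R)) :
  F !=set0 -> total_on F subset -> (forall X, F X -> is_ideal X) ->
  is_ideal (\bigcup_(X in F) X).
Proof.
move=> [X0 FX0] Ftot Fid; split.
- by exists X0 => //; case: (Fid _ FX0).
- move=> x y Ux Uy; have [X [FX Xx Xy]] := total_on_bigcup2 Ftot Ux Uy.
  by exists X => //; case: (Fid _ FX) => _ + _; apply.
- by move=> r x [X FX Xx]; exists X => //; case: (Fid _ FX) => _ _; apply.
Qed.

(** Take [M] maximal among the subrings containing [S] and missing [v]. A subring containing both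
    [M] and [v] is everything, so proper subrings above [M] still miss [v]. *)
Lemma maximal_subring_of_adjoin (R : comNzRingType) (S : R -> Prop) (v : R) :
  is_subring S -> ~ S v -> (forall t, exists k s, S s /\ t = v ^+ k * s) ->
  exists M : R -> Prop, is_maximal_subring M.
Proof.
move=> subS Sv gen.
have [|F F0 FP Ftot|M [[subM Mv] SM maxM]] :=
  @chain_complete_maximal R (fun X => is_subring X /\ ~ X v) S.
- by [].
- split; first by apply: bigcup_subring => // X /FP[].
  by case=> X FX Xv; case: (FP X FX).
exists M; split=> [//||S' subS' [x S'x] MS']; first by exists v.
have S'v : ~ S' v.
  case: (subS') => S'1 _ S'M S'v; apply: S'x.
  have [k [s [Ss ->]]] := gen x; apply: (S'M); last exact/MS'/SM.
  by elim: k => [|k IHk]; rewrite ?expr0 // exprS; apply: S'M.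
exact: (maxM S').
Qed.

Lemma maximal_subring_preimage (R Q : comNzRingType) (f : {rmorphism R -> Q}) :
  (forall q, exists x, f x = q) ->
  (exists M : Q -> Prop, is_maximal_subring M) ->
  exists M : R -> Prop, is_maximal_subring M.
Proof.
move=> fsurj [M [[M1 MB MM] [q Mq] maxM]].
exists (fun x => M (f x)); split.
- split=> [|x y|x y]; rewrite ?rmorph1 ?rmorphB ?rmorphM //; first exact: MB.
  exact: MM.
- by have [x fx] := fsurj q; exists x; rewrite fx.
move=> S' [S'1 S'B S'M] [x S'x] MS'.
(* [S'] contains the kernel of [f], so it is a union of fibres and its image stays proper. *)
have S'ker y z : f y = f z -> S' y -> S' z.
  move=> fyz S'y; rewrite -[z](subKr y); apply: (S'B) => //; apply: MS'.
  rewrite rmorphB fyz subrr -[0]/(0 : Q) -(subrr 1); exact: MB.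
have : forall a, (exists2 y, S' y & f y = a) -> M a.
  apply: maxM.
  - split.
    + by exists 1; rewrite ?rmorph1.
    + move=> _ _ [y S'y <-] [z S'z <-]; exists (y - z); rewrite ?rmorphB //.
      exact: S'B.
    + move=> _ _ [y S'y <-] [z S'z <-]; exists (y * z); rewrite ?rmorphM //.
      exact: S'M.
  - by exists (f x); case=> y S'y fyx; apply: S'x; apply: S'ker S'y.
  - by move=> a Ma; have [y fy] := fsurj a; exists y => //; apply: MS'; rewrite fy.
by move=> imM y S'y; apply: imM; exists y.
Qed.

(** * Prime ideals avoiding a multiplicative set *)

Lemma ideal_adjoin (R : comNzRingType) (I : R -> Prop) (x : R) :
  is_ideal I -> is_ideal (fun z => exists p r, I p /\ z = p + r * x).
Proof.
case=> I0 ID IM; split.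
- by exists 0, 0; rewrite mul0r addr0.
- move=> _ _ [p [r [Ip ->]]] [q [s [Iq ->]]]; exists (p + q), (r + s).
  by rewrite mulrDl addrACA; split=> //; apply: ID.
- move=> a _ [p [r [Ip ->]]]; exists (a * p), (a * r).
  by rewrite mulrDr mulrA; split=> //; apply: IM.
Qed.

(** Take [P] maximal among the ideals containing [I] and missing [W]. If [x] and [y] lie outside
    [P], then [P + (x)] and [P + (y)] meet [W]; the product of the two meeting points lies in [W],
    and would lie in [P] if [x * y] did. *)
Lemma prime_ideal_avoiding (R : comNzRingType) (I W : R -> Prop) :
  is_ideal I -> W 1 -> (forall x y, W x -> W y -> W (x * y)) ->
  (forall x, W x -> ~ I x) ->
  exists P : R -> Prop,
    [/\ is_prime_ideal P, forall x, I x -> P x & forall x, W x -> ~ P x].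
Proof.
move=> idI W1 WM WI.
have [|F F0 FP Ftot|P [[idP WP] IP maxP]] := @chain_complete_maximal R
  (fun X => is_ideal X /\ forall x, W x -> ~ X x) I.
- by [].
- split; first by apply: bigcup_ideal => // X /FP[].
  by move=> x Wx [X FX Xx]; case: (FP X FX) => _ /(_ x Wx).
exists P; split=> //; split=> //; first exact: WP.
have [P0 PD PM] := idP.
have meetW x : ~ P x -> exists r p, P p /\ W (p + r * x).
  move=> Px; apply: contrapT => nW; apply: Px.
  apply: (maxP (fun z => exists p r, P p /\ z = p + r * x)).
  - split; first exact: ideal_adjoin.
    by move=> w Ww [p [r [Pp Ew]]]; apply: nW; exists r, p; rewrite -Ew.
  - by move=> p Pp; exists p, 0; rewrite mul0r addr0.
  - by exists 0, 1; rewrite mul1r add0r.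
move=> x y Pxy; apply: contrapT => /not_orP[/meetW[r [p [Pp Wx]]]].
move=> /meetW[s [q [Pq Wy]]]; apply: (WP _ (WM _ _ Wx Wy)).
have -> : (p + r * x) * (q + s * y) =
  (q + s * y) * p + (r * x * q + r * s * (x * y)).
  by rewrite mulrDl mulrC mulrDr (mulrACA r x).
by apply: (PD); [|apply: PD]; apply: PM.
Qed.

(** Otherwise [P + (x)] is proper, hence inside a prime [Q], and [0 < P < Q] is a chain of length
    2. *)
Lemma nonzero_prime_quotient_field (R : idomainType) (P : R -> Prop) (x : R) :
  krull_dim_one R -> is_prime_ideal P -> (exists2 z, P z & z != 0) -> ~ P x ->
  exists y, P (x * y - 1).
Proof.
move=> [_ dim1] primeP [z Pz z0] Px; have [idP P1 _] := primeP.
apply: contrapT => xinv.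
have [|||w ->|Q [primeQ IQ _]] := @prime_ideal_avoiding R
  (fun z => exists p r, P p /\ z = p + r * x) (fun w => w = 1).
- exact: ideal_adjoin.
- by [].
- by move=> a b -> ->; rewrite mulr1.
- case=> p [r [Pp pr]]; apply: xinv; exists r.
  have -> : x * r - 1 = -1 * p by rewrite mulN1r pr opprD addrCA mulrC subrr addr0.
  by case: idP => _ _; apply.
apply: dim1; exists (fun x => x = 0), P, Q; split=> //.
- split; last by move=> a b /eqP; rewrite mulf_eq0 => /orP[]/eqP; [left|right].
  + by split=> [//|a b -> ->|r a ->]; rewrite ?addr0 ?mulr0.
  + by move/eqP; rewrite oner_eq0.
- split=> [a ->|]; first by case: idP.
  by exists z; split=> //; apply/eqP.
- split=> [a Pa|]; first by apply: IQ; exists a, 0; rewrite mul0r addr0.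
  by exists x; split=> //; apply: IQ; exists 0, 1; rewrite mul1r add0r; case: idP.
Qed.

(** * Integrality over a polynomial ring *)

(* The witness is [g^n p(x/g)] for [p] of degree [n.+1] with leading
   coefficient [g]. *)
Lemma integral_lead_coef_root (R K : comNzRingType) (f : {rmorphism R -> K})
    (p : {poly R}) (t : K) :
  (map_poly f p).[t] = 0 -> integralOver f (f (lead_coef p) * t).
Proof.
move=> pt0; case sp: (size p) => [|[|n]].
- by rewrite lead_coefE sp (nth_default 0) ?sp // rmorph0 mul0r; apply: integral0.
- have p_const := size1_polyC (eq_leq sp); move: pt0.
  rewrite lead_coefE sp {1}p_const map_polyC hornerC => ->.
  by rewrite mul0r; apply: integral0.
pose g := lead_coef p.
exists ('X^(n.+1) + \poly_(i < n.+1) (p`_i * g ^+ (n - i))).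
  rewrite monicE lead_coefDl ?lead_coefXn // size_polyXn ltnS.
  exact: size_poly.
rewrite rootE rmorphD /= map_polyXn hornerD hornerXn.
rewrite (@horner_coef_wide _ n.+1); last first.
  by rewrite (leq_trans (size_poly _ _)) // size_poly.
apply/eqP; transitivity (f g ^+ n * (map_poly f p).[t]); last by rewrite pt0 mulr0.
rewrite (@horner_coef_wide _ n.+2 (map_poly f p)); last first.
  by rewrite (leq_trans (size_poly _ _)) ?sp.
rewrite [in RHS]big_ord_recr /= addrC mulrDr mulr_sumr; congr (_ + _).
  by rewrite coef_map /= /g lead_coefE sp /= mulrA exprMn exprSr.
  apply: eq_bigr => i _; rewrite !coef_map coef_poly ltn_ord /= rmorphM rmorphXn.
  have in_ : (i <= n)%N by rewrite -ltnS.
  rewrite -/g exprMn -!mulrA (mulrA (f g ^+ (n - i))) -exprD subnK //.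
  by rewrite mulrCA.
Qed.

(* [S] is the set of elements of [T] integral over [A[X]] localized at the
   polynomials with nonzero constant term; [X] is not invertible in it. *)
Lemma maximal_subring_of_algebraic_over_poly (T : idomainType)
    (A : comNzRingType) (f : {rmorphism {poly A} -> T}) (v : T) :
  injective f -> f 'X * v = 1 ->
  (forall t, exists2 p : {poly {poly A}}, p != 0 & (map_poly f p).[t] = 0) ->
  exists M : T -> Prop, is_maximal_subring M.
Proof.
move=> f_inj Xv f_alg.
have f0 p : (f p == 0) = (p == 0) by rewrite -(inj_eq f_inj) rmorph0.
(* [A] has no zero divisors, since it embeds in the domain [T] as constants. *)
have A_mulf (w z : {poly A}) : w`_0 != 0 -> z`_0 != 0 -> (w * z)`_0 != 0.
  have fC (a : A) : (f a%:P == 0) = (a == 0) by rewrite f0 polyC_eq0.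
  by rewrite coef0M -3!fC polyCM rmorphM; exact: mulf_neq0.
pose S t := exists2 w : {poly A}, w`_0 != 0 & integralOver f (f w * t).
apply: (@maximal_subring_of_adjoin T S v).
- split.
  + by exists 1; rewrite ?coef1 ?oner_eq0 // rmorph1 mulr1; apply: integral1.
  + move=> s t [w w0 ws] [z z0 zt]; exists (w * z); first exact: A_mulf.
    rewrite mulrBr rmorphM -mulrA mulrCA -(mulrA (f w)).
    by apply: integral_sub; apply: integral_mul => //; exact: integral_id.
  + move=> s t [w w0 ws] [z z0 zt]; exists (w * z); first exact: A_mulf.
    by rewrite rmorphM mulrACA; apply: integral_mul.
- case=> w w0 [p p_monic]; rewrite rootE => pwv.
  pose n := (size p).-1.
  have sp : size p = n.+1 by rewrite prednK // size_poly_gt0 monic_neq0.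
  (* Multiplying the monic equation of [f w * v] by [f 'X ^+ n] clears the powers of [v] and gives
     [f q = 0]; yet the constant term of [q] is that of [w ^+ n], which is nonzero. *)
  pose q : {poly A} := \sum_(i < n.+1) p`_i * w ^+ i * 'X^(n - i).
  have : f q = 0.
    transitivity (f 'X ^+ n * (map_poly f p).[f w * v]); last first.
      by rewrite (eqP pwv) mulr0.
    rewrite (@horner_coef_wide _ n.+1); last first.
      by rewrite (leq_trans (size_poly _ _)) ?sp.
    rewrite rmorph_sum mulr_sumr; apply: eq_bigr => i _.
    have in_ : (i <= n)%N by rewrite -ltnS.
    have -> : f 'X ^+ n = f 'X ^+ (n - i) * f 'X ^+ i by rewrite -exprD subnK.
    rewrite !rmorphM !rmorphXn coef_map /= exprMn.
    transitivity (f p`_i * f w ^+ i * f 'X ^+ (n - i) * (f 'X * v) ^+ i).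
      by rewrite Xv expr1n mulr1.
    by rewrite exprMn; ring.
  move=> /eqP; rewrite f0 => /eqP/(congr1 (horner^~ 0)).
  rewrite horner0 horner_sum big_ord_recr /= big1 ?add0r; last first.
    move=> i _; rewrite hornerM hornerXn expr0n subn_eq0 leqNgt ltn_ord.
    by rewrite mulr0.
  rewrite subnn expr0 mulr1 -[n]/(size p).-1 -lead_coefE (monicP p_monic) mul1r.
  rewrite horner_exp horner_coef0 => /eqP.
  by rewrite -polyC_eq0 -f0 !rmorphXn /= expf_eq0 f0 polyC_eq0 (negPf w0) andbF.
- move=> t; have [p p0 pt] := f_alg t.
  have g0 : lead_coef p != 0 by rewrite lead_coef_eq0.
  (* [k] is the order of vanishing at 0 of the leading coefficient; splitting off ['X^k] leaves a
     denominator allowed in [S]. *)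
  have [k gk kmin] : exists2 k, (lead_coef p)`_k != 0 &
      forall i, (i < k)%N -> (lead_coef p)`_i = 0.
    have ex : exists k, (lead_coef p)`_k != 0.
      by exists (size (lead_coef p)).-1; rewrite -lead_coefE lead_coef_eq0.
    exists (ex_minn ex); first by case: ex_minnP.
    case: ex_minnP => k _ kmin i ik; apply/eqP; apply: contraLR ik => /kmin.
    by rewrite -leqNgt.
  have gE : lead_coef p = drop_poly k (lead_coef p) * 'X^k.
    apply/polyP => i; rewrite coefMXn coef_drop_poly; case: ltnP => [/kmin //|ki].
    by rewrite subnK.
  exists k, (f 'X ^+ k * t); split; last by rewrite mulrA -exprMn (mulrC v) Xv expr1n mul1r.
  exists (drop_poly k (lead_coef p)); first by rewrite coef_drop_poly.
  by rewrite mulrA -rmorphXn -rmorphM -gE; apply: integral_lead_coef_root.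
Qed.

(** * Transcendental units *)

(** The conclusion concerns the image of [p] in [R], so that in positive characteristic this is
    transcendence over the prime field. *)
Definition transcendental (R : nzRingType) (x : R) :=
  forall p : {poly int}, (map_poly intr p).[x] = 0 ->
    map_poly intr p = 0 :> {poly R}.

Lemma map_poly_lift (R K : nzRingType) (f : {rmorphism R -> K}) (p : {poly K}) :
  (forall i, exists a, f a = p`_i) -> exists q, map_poly f q = p.
Proof.
move=> /choice[a fa]; exists (\poly_(i < size p) a i).
apply/polyP => i; rewrite coef_map coef_poly.
case: ltnP => [_|pi]; [exact: fa|]. by rewrite nth_default // [LHS]rmorph0.
Qed.

Lemma total_on_bigcup_seq (U : Type) (F : set (set U)) (s : nat -> U) (n : nat) :
  F !=set0 -> total_on F subset ->
  (forall i, (\bigcup_(X in F) X) (s i)) ->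
  exists2 X, F X & forall i, (i < n)%N -> X (s i).
Proof.
move=> [X0 FX0] Ftot Us; elim: n => [|n [X FX Xs]]; first by exists X0.
have [Y FY Ys] := Us n; have [XY|YX] := Ftot _ _ FX FY.
- exists Y => // i; rewrite ltnS leq_eqVlt => /predU1P[-> //|/Xs]; exact: XY.
- exists X => // i; rewrite ltnS leq_eqVlt => /predU1P[->|/Xs //]; exact: YX.
Qed.

Definition transcendental_over (R : nzRingType) (S : R -> Prop) (x : R) :=
  forall p : {poly R}, (forall i, S p`_i) -> p.[x] = 0 -> p = 0.

Lemma maximal_subring_of_transcendental_unit (T : idomainType) (u v : T) :
  u * v = 1 -> transcendental u -> exists M : T -> Prop, is_maximal_subring M.
Proof.
move=> uv trans_u.
have [|F F0 FP Ftot|S [[subS tr_u] _ maxS]] := @chain_complete_maximal T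
  (fun X => is_subring X /\ transcendental_over X u)
  (fun x => exists n : int, n%:~R = x).
- split; last first.
    by move=> p /(@map_poly_lift int T intr)[q <-]; apply: trans_u.
  split; first by exists 1.
  + by move=> _ _ [m <-] [n <-]; exists (m - n); rewrite rmorphB.
  + by move=> _ _ [m <-] [n <-]; exists (m * n); rewrite rmorphM.
- split; first by apply: bigcup_subring => // X /FP[].
  move=> p Fp; have [X FX Xp] := total_on_bigcup_seq (size p) F0 Ftot Fp.
  have [subX trX] := FP _ FX; apply: trX => i.
  have [/Xp //|pi] := ltnP i (size p).
  by rewrite nth_default //; apply: subring0.
have [A [f [f_inj SE]]] := subring_range_rmorphism subS.
have eval_comm t : commr_rmorph f t by move=> a; apply: mulrC.
pose eval t : {rmorphism {poly A} -> T} := horner_morph (eval_comm t).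
apply: (@maximal_subring_of_algebraic_over_poly T A (eval u) v).
- move=> p q epq; apply: (map_inj_poly f_inj (rmorph0 f)).
  apply/eqP; rewrite -subr_eq0 -rmorphB; apply/eqP/tr_u => [i|].
    by rewrite coef_map SE; exists (p - q)`_i.
  by rewrite -[LHS]/(eval u (p - q)) rmorphB epq subrr.
- by rewrite [eval u _]horner_morphX.
move=> t; have [/SE[a fa]|nSt] := pselect (S t).
  exists ('X - (a%:P)%:P); first by rewrite polyXsubC_eq0.
  rewrite rmorphB /= map_polyX map_polyC !hornerE /=.
  by rewrite [eval u _]horner_morphC fa subrr.
(* Were [u] transcendental over [S[t]], maximality of [S] would put [t] in [S]. *)
have [r [r0 ru]] : exists r : {poly {poly A}}, r != 0 /\ (map_poly (eval t) r).[u] = 0.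
  apply: contrapT => nr; apply: nSt.
  apply: (maxS (fun x => exists q, eval t q = x)).
  - split; first split.
    + by exists 1; rewrite rmorph1.
    + by move=> _ _ [p <-] [q <-]; exists (p - q); rewrite rmorphB.
    + by move=> _ _ [p <-] [q <-]; exists (p * q); rewrite rmorphM.
    move=> p /map_poly_lift[r <-] ru; apply: contrapT => /eqP r0; apply: nr.
    by exists r; split=> //; apply: contraNneq r0 => ->; rewrite rmorph0.
  - by move=> x /SE[a <-]; exists a%:P; rewrite [eval t _]horner_morphC.
  - by exists 'X; rewrite [eval t _]horner_morphX.
(* Swapping the variables turns a relation for [u] over [A[t]] into one for [t] over [A[u]]. *)
exists (swapXY r); first by rewrite swapXY_eq0.
have mapE x q : map_poly (eval x) q =
    map_poly (horner_eval x) (map_poly (map_poly f) q).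
  by rewrite -map_poly_comp; apply: eq_map_poly.
rewrite mapE -[t](hornerC t u) [LHS]horner_map /= /horner_eval -swapXY_map.
rewrite horner2_swapXY -ru mapE -[in RHS](hornerC u t) [RHS]horner_map.
by [].
Qed.

(** * Counting arguments *)

(** [D] is covered by the finite root sets of countably many nonzero polynomials. *)
Lemma countable_of_algebraic (D : idomainType) :
  (forall x : D, ~ transcendental x) -> exists c : D -> nat, injective c.
Proof.
move=> alg.
have : countable [set: D].
  apply: (@sub_countable _ _ _
    (\bigcup_(p in [set p : {poly int} | map_poly intr p != 0 :> {poly D}])
       [set x : D | (map_poly intr p).[x] = 0])).
    apply: subset_card_le => x _.
    have /existsNP[p /not_implyP[px /eqP p0]] := alg x.
    by exists p.
  apply: bigcup_countable => [|p p0]; first exact: countableP.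
  apply: finite_set_countable; apply: contrapT.
  move=> /(infinite_set_fset (size (map_poly intr p : {poly D})))[X Xroots].
  apply/negP; rewrite -ltnNge; apply: max_poly_roots => //.
  - by apply/allP => x /Xroots px; apply/rootP.
  - exact: finmap.fset_uniq.
move=> /countable_injP[c c_inj]; exists c => x y; apply: c_inj; exact/mem_set.
Qed.

Lemma no_injection_powerset (U : Type) (g : (U -> Prop) -> U) : ~ injective g.
Proof.
move=> g_inj; pose d : U -> Prop := fun s => exists2 X, g X = s & ~ X s.
have nd : ~ d (g d) by move=> dgd; have [X /g_inj -> nd] := dgd; apply: nd.
by apply: (nd); exists d.
Qed.

(** Coding a sequence by its graph would inject the double power set of [nat] into its power set,
    against Cantor. *)
Lemma card_2_2_aleph0_not_inj (U : Type) (f : U -> nat -> nat) :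
  card_2_2_aleph0 U -> ~ injective f.
Proof.
move=> [h [h' _ hK]] f_inj.
pose graph (s : nat -> nat) : nat -> Prop :=
  fun n => exists i, n = pickle (i, s i).
apply: (@no_injection_powerset (nat -> Prop) (graph \o f \o h')).
apply: inj_comp (can_inj hK); apply: inj_comp f_inj => s t st.
apply/funext => i.
have : graph t (pickle (i, s i)) by rewrite -st; exists i.
by case=> j /(pcan_inj pickleK)[<-].
Qed.

(** * Nonzero primes in a domain without maximal subrings *)

Theorem theorem2p24 (T : idomainType) :
  card_2_2_aleph0 T -> krull_dim_one T ->
  exists S : T -> Prop, is_maximal_subring S.
Proof.
move=> cardT dimT; apply: contrapT => noM.
have quot_algebraic (P : T -> Prop) : is_prime_ideal P ->
    (exists2 z, P z & z != 0) ->
    exists (D : idomainType) (f : {rmorphism T -> D}),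
      (forall x, f x = 0 <-> P x) /\ forall x : D, ~ transcendental x.
  move=> primeP nzP; have [D [f [fsurj fP]]] := prime_ideal_quotient primeP.
  exists D, f; split=> // x trans_x; apply: noM.
  apply: (maximal_subring_preimage fsurj); have [a fa] := fsurj x.
  have [|b Pab] := nonzero_prime_quotient_field (x := a) dimT primeP nzP.
    move/fP; rewrite fa => x0; have := trans_x 'X.
    by rewrite map_polyX hornerX => /(_ x0)/eqP; rewrite polyX_eq0.
  apply: (maximal_subring_of_transcendental_unit (v := f b)) trans_x.
  by apply/eqP; rewrite -fa -rmorphM -subr_eq0 -(rmorph1 f) -rmorphB; apply/eqP/fP.
have [y trans_y] : exists y : T, transcendental y.
  apply/not_existsP => alg; have [c c_inj] := countable_of_algebraic alg.
  apply: (@card_2_2_aleph0_not_inj T (fun x _ => c x) cardT).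
  by move=> s t /(congr1 (@^~ 0%N))/c_inj.
pose B (p : {poly int}) : T := (map_poly intr p).[y].
(* The ideals are indexed by all integer polynomials, with the whole ring as default when [B p = 0];
   the code [c] says that [T] modulo [M] is countable. *)
have /choice[M_ /all_and3[idM BM cM]] : forall p, exists M : T -> Prop,
    [/\ is_ideal M, B p != 0 -> ~ M (B p) &
      exists c : T -> nat, forall s t, c s = c t -> M (s - t)].
  move=> p; have [Bp0|Bp_neq0] := eqVneq (B p) 0.
    by exists (fun=> True); split=> //; exists (fun=> 0%N).
  pose r := p * 'X + 1%:P.
  have rE : map_poly intr r = map_poly intr p * 'X + 1%:P :> {poly T}.
    by rewrite rmorphD rmorphM /= map_polyX map_polyC /= rmorph1.
  have p_neq0 : map_poly intr p != 0 :> {poly T}.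
    by apply: contraNneq Bp_neq0; rewrite /B => ->; rewrite horner0.
  have size_r : (1 < size (map_poly intr r : {poly T}))%N.
    by rewrite rE size_MXaddC (negPf p_neq0) /= ltnS size_poly_gt0.
  have Br : B r = B p * y + 1 by rewrite /B rE !hornerE.
  have trans_r : transcendental (B r).
    (* A relation [q] for [B r] gives the relation [q \Po r] for [y], and composing with the
       nonconstant [r] kills only 0. *)
    move=> q qr0; have /trans_y/eqP : B (q \Po r) = 0.
      by rewrite /B map_comp_poly horner_comp.
    by rewrite map_comp_poly /= comp_poly_eq0 // => /eqP.
  have Br_neq0 : B r != 0.
    apply/eqP => /trans_y r0; move: size_r.
    by rewrite r0 size_poly0.
  have [|||_ ->|M [primeM wM _]] := @prime_ideal_avoiding T
      (fun z => exists a, z = a * B r) (fun w => w = 1).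
  - split; first by exists 0; rewrite mul0r.
    + by move=> _ _ [a ->] [b ->]; exists (a + b); rewrite mulrDl.
    + by move=> a _ [b ->]; exists (a * b); rewrite mulrA.
  - by [].
  - by move=> a b -> ->; rewrite mulr1.
  - case=> v Brv; apply: noM.
    apply: (maximal_subring_of_transcendental_unit (v := v)) trans_r.
    by rewrite mulrC.
  have MBr : M (B r) by apply: wM; exists 1; rewrite mul1r.
  have [idM M1 _] := primeM; have [_ MD MM] := idM.
  exists M; split=> // [_ MBp|].
    apply: M1; rewrite (_ : 1 = B r + - y * B p).
      by apply: MD => //; exact: MM.
    by rewrite Br mulNr addrAC (mulrC y) subrr add0r.
  have [D [f [fM alg]]] := quot_algebraic M primeM
    (ex_intro2 _ (fun z => z != 0) _ MBr Br_neq0).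
  have [c c_inj] := countable_of_algebraic alg.
  exists (c \o f) => s t /c_inj fst; apply/fM.
  by rewrite rmorphB fst subrr.
have [c_ cE] := choice cM.
have [z Mz z_neq0] : exists2 z, (forall p, M_ p z) & z != 0.
  apply: contrapT => M0.
  (* [F t] lists all residue codes of [t]; if the [M_ p] met only in 0, it would be injective. *)
  pose F t n := if unpickle n is Some p then c_ p t else 0%N.
  apply: (@card_2_2_aleph0_not_inj T F cardT) => s t Fst.
  apply/eqP; rewrite -subr_eq0; apply: contrapT => /negP st; apply: M0.
  exists (s - t); last by [].
  move=> p; apply: cE; have := congr1 (@^~ (pickle p)) Fst.
  by rewrite /F pickleK.
have [||||P [primeP MP WP]] := @prime_ideal_avoiding T
    (fun x => forall p, M_ p x) (fun x => x != 0 /\ exists p, B p = x).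
- split=> [p|x t Mx Mt p|r x Mx p]; have [I0 ID IM] := idM p => //.
  + exact: ID.
  + exact: IM.
- by split; [exact: oner_neq0 | exists 1; rewrite /B rmorph1 hornerC].
- move=> x t [x0 [p xE]] [t0 [q tE]]; split; first exact: mulf_neq0.
  by exists (p * q); rewrite -xE -tE /B rmorphM hornerM.
- by move=> x [x0 [p xE]] /(_ p); rewrite -xE; apply: BM; rewrite xE.
(* A relation for [f y] puts some [B p] in [P], which forces [B p = 0], a relation for [y]
   itself. *)
have [D [f [fP alg]]] := quot_algebraic P primeP
  (ex_intro2 _ (fun z => z != 0) z (MP _ Mz) z_neq0).
apply: (alg (f y)) => p.
have intrE : map_poly intr p = map_poly f (map_poly intr p).
  by rewrite -map_poly_comp; apply: eq_map_poly => n /=; rewrite rmorph_int.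
rewrite intrE horner_map => /fP PBp; rewrite (trans_y p) ?rmorph0 //.
apply/eqP; apply: contrapT => /negP Bp0; apply: (WP _ _ PBp).
by split=> //; exists p.
Qed.
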